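(* (1) If $g\colon S^2\to S^2$ is a NET map and $h\colon S^2\to S^2$ is an orientation-preserving homeomorphism such that $h(P_g)\subseteq g^{-1}(P_g)$, then $f=h\circ g$ is a NET map if it has at least four postcritical points. (2) Let $f$ be a NET map with $P_1=P_1(f)$ and $P_2=P_2(f)$. Let $h\colon S^2\to S^2$ be any orientation-preserving homeomorphism with $h(P_1)=P_2$. Then $f=h\circ g$, where $g\colon S^2\to S^2$ is a Euclidean Thurston map with $P_g=P_1$ and $P_2\subseteq g^{-1}(P_g)$, so that $h(P_g)\subseteq g^{-1}(P_g)$.
   Context: A Thurston map is an orientation-preserving branched covering map $f\colon S^2\to S^2$ whose postcritical set $P_f=\{f^{\circ m}(c): m\ge 1,\ c \text{ a critical point of } f\}$ is finite. A Thurston map is Euclidean if its degree is at least 2, its local degree at each of its critical points is 2, it has at most four postcritical points, and none of its postcritical points is critical. A Thurston map is nearly Euclidean (a NET map) if its local degree at each of its critical points is 2 and it has exactly four postcritical points. For a NET map $f$ there are degree 2 branched coverings $p_1\colon T_1\to S^2$, $p_2\colon T_2\to S^2$ from tori and a continuous map $\widetilde f\colon T_1\to T_2$ with $p_2\circ\widetilde f=f\circ p_1$ such that the set of branch points of $p_2$ is $P_f$. One writes $P_2(f)=P_f$ and $P_1(f)$ for the set of branch points of $p_1$ in $S^2$; equivalently, $P_1(f)$ is the set of those points of $f^{-1}(P_f)$ which are not critical points of $f$, and it has exactly four elements. *)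

(* Defs.v *)
From HB Require Import structures.
From mathcomp Require Import all_boot all_order all_algebra.
From mathcomp Require Import complex.
From mathcomp Require Import all_classical all_reals all_analysis.

Set Implicit Arguments.
Unset Strict Implicit.
Unset Printing Implicit Defensive.

Import Order.TTheory GRing.Theory Num.Theory.
Import numFieldNormedType.Exports.

Local Open Scope classical_set_scope.
Local Open Scope card_scope.
Local Open Scope ring_scope.
Local Open Scope complex_scope.

(* [(complex R)^o] is [R[i]] with the topology of its norm (a bare [R[i]] has no
   topology); the oriented 2-sphere is modelled by the Riemann sphere, [None]
   being the point at infinity. *)
Notation plane R := (complex R)^o.
Notation sphere R := (one_point_compactification (plane R)).

Section NET.
Context {R : realType}.
Local Notation C := (plane R).
Local Notation S2 := (sphere R).

Definition homeomorphism (h : S2 -> S2) : Prop :=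
  continuous h /\
  exists2 k : S2 -> S2, continuous k & cancel h k /\ cancel k h.

(* The two standard holomorphic coordinates of the Riemann sphere: [z] near a
   finite point [p], and [1/z] near infinity. The value at the pole of the
   coordinate (the value 0) is junk and is only avoided by working near [p]. *)
Definition sphere_coord (p x : S2) : C :=
  match p, x with
  | Some _, Some z => z
  | Some _, None => 0
  | None, Some z => z^-1
  | None, None => 0
  end.

Definition loop_in (A : set S2) (gamma : R -> S2) : Prop :=
  [/\ {within `[0, 1]%classic, continuous gamma},
      gamma 0 = gamma 1 &
      forall t : R, t \in `[0, 1] -> A (gamma t)].

(* [theta] is a continuous determination of the argument of [gamma - z0]. *)
Definition winding_number (gamma : R -> C) (z0 : C) (n : int) : Prop :=
  exists theta : R -> R,
    [/\ {within `[0, 1]%classic, continuous theta},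
        forall t : R, t \in `[0, 1] -> gamma t != z0,
        forall t : R, t \in `[0, 1] ->
          gamma t - z0 = `|gamma t - z0| * (cos (theta t) +i* sin (theta t)) &
        theta 1 - theta 0 = 2 * pi * n%:~R].

(* Local degree 1 at [p]: [u] induces the identity of Z on the first homology
   of punctured neighbourhoods, i.e. it preserves the winding numbers of small
   loops around [p]. *)
Definition orientation_preserving_at (u : S2 -> S2) (p : S2) : Prop :=
  exists2 N : set S2, nbhs p N &
    forall (gamma : R -> S2) (n : int), loop_in (N `\ p) gamma ->
      winding_number (sphere_coord p \o gamma) (sphere_coord p p) n <->
      winding_number (sphere_coord (u p) \o u \o gamma) (sphere_coord (u p) (u p)) n.

Definition orientation_preserving (u : S2 -> S2) : Prop :=
  forall p, orientation_preserving_at u p.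

(* [phi] restricts to an orientation-preserving homeomorphism from the open
   neighbourhood [U] of [p] onto an open subset of the plane, with [p] sent
   to 0; the plane is oriented as a subset of the Riemann sphere. *)
Definition oriented_chart (U : set S2) (phi : S2 -> C) (p : S2) : Prop :=
  [/\ open U, U p & phi p = 0] /\
  [/\ forall x, U x -> {for x, continuous phi},
      {in U &, injective phi},
      forall W : set S2, open W -> W `<=` U -> open (phi @` W) &
      forall x, U x -> orientation_preserving_at (fun y => Some (phi y) : S2) x].

(* In oriented charts centred at [p] and [f p], [f] reads [z |-> z ^ d]. *)
Definition local_degree (f : S2 -> S2) (p : S2) (d : nat) : Prop :=
  (0 < d)%N /\
  exists (U V : set S2) (phi psi : S2 -> C),
    [/\ oriented_chart U phi p,
        oriented_chart V psi (f p),
        f @` U `<=` V &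
        forall x, U x -> psi (f x) = phi x ^+ d].

Definition oriented_branched_covering (f : S2 -> S2) : Prop :=
  continuous f /\ forall p, exists d, local_degree f p d.

Definition critical (f : S2 -> S2) : set S2 :=
  [set c | exists2 d, (2 <= d)%N & local_degree f c d].

Definition postcritical (f : S2 -> S2) : set S2 :=
  [set y | exists m c, [/\ (1 <= m)%N, critical f c & y = iter m f c]].

(* The degree is the common cardinality of the fibres over noncritical
   values. *)
Definition has_degree (f : S2 -> S2) (d : nat) : Prop :=
  forall y, ~ (f @` critical f) y -> f @^-1` [set y] #= `I_d.

Definition thurston_map (f : S2 -> S2) : Prop :=
  oriented_branched_covering f /\ finite_set (postcritical f).

Definition euclidean (f : S2 -> S2) : Prop :=
  thurston_map f /\
  [/\ exists2 d, (2 <= d)%N & has_degree f d,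
      forall c, critical f c -> local_degree f c 2,
      postcritical f #<= `I_4 &
      postcritical f `&` critical f = set0].

Definition NET_map (f : S2 -> S2) : Prop :=
  [/\ thurston_map f,
      forall c, critical f c -> local_degree f c 2 &
      postcritical f #= `I_4].

Definition P1 (f : S2 -> S2) : set S2 :=
  f @^-1` postcritical f `\` critical f.

Definition P2 (f : S2 -> S2) : set S2 := postcritical f.

End NET.

(* Main.v *)
Require Import Defs.
From mathcomp Require Import all_boot all_order all_algebra.
From mathcomp Require Import finmap complex zify.
From mathcomp Require Import all_classical all_reals all_analysis.

Set Implicit Arguments.
Unset Strict Implicit.
Unset Printing Implicit Defensive.

Import Order.TTheory GRing.Theory Num.Theory.
Import numFieldNormedType.Exports.

Local Open Scope classical_set_scope.
Local Open Scope card_scope.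
Local Open Scope ring_scope.

(** The first part is bookkeeping.  Post-composition with an
orientation-preserving homeomorphism [h] changes neither critical points nor
local degrees ([local_degree_postcomp], [critical_postcomp]), and the
hypothesis on [h] makes [h @` postcritical g] forward invariant under
[h \o g].  As that set has four points and contains the critical values of
[h \o g], it bounds the postcritical set of [h \o g].

In the second part the candidate is [g = h^-1 \o f].  From [h @` P1 f = P2 f]
it follows at once that [postcritical g] lies in [P1 f], and hence contains no
critical point.  What has to be excluded is that it is smaller, i.e. has at
most three points.  This is a Riemann-Hurwitz count, but no Euler
characteristic is needed, because [f] itself supplies the number of its
critical points.  Count a critical point twice and any other point once; then
every fibre of [f] has the same weight [d], the degree.  As [P2 f] has four
points and its preimage consists of the four points of [P1 f] and of the [K]
critical points, [4 d = 4 + 2 K].  Put [Q = h @` postcritical g] and [k = #Q].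
The preimage of [Q] under [f] contains all critical points and, besides them,
the [k] points of [postcritical g], so [k d >= k + 2 K = k + 4 (d - 1)], that
is [(k - 4) (d - 1) >= 0].  Since [f] has a critical point, [d >= 2], and so
[k >= 4] ([four_le_card]).

The analytic content is thus the constancy of the weight of a fibre
([fibre_sum_constant]).  By the normal form [z |-> z ^+ d] with [d <= 2], which
only asks for square roots in the plane, each point has arbitrarily small
neighbourhoods meeting every nearby fibre in the weight of that point; for this
one needs that criticality is a topological notion, namely the failure of local
injectivity.  Compactness and separation of the sphere then make the weight of
a fibre locally constant, and connectedness makes it constant. *)

(** * Weighted fibres of a map on a compact space *)

Section FibreSums.
Context {X : ptopologicalType} {Y : topologicalType}.
Variables (f : X -> Y) (m : X -> nat).

Local Notation fibre y := (f @^-1` [set y]).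

(** The total mass of the points of [fibre y] close to [x] is the mass of [x]
as soon as [y] is close to [f x]: what the local degree satisfies. *)
Definition locally_constant_mass :=
  forall (x : X) (W : set X), nbhs x W ->
  exists N : set X, [/\ open N, N x, N `<=` W &
    \forall y \near f x, finite_set (N `&` fibre y) /\
      (\sum_(z \in N `&` fibre y) m z)%N = m x].

Lemma separate_point_seq (x : X) (s : seq X) :
  hausdorff_space X -> x \notin s ->
  exists A B : set X, [/\ open A, open B, A x, [set` s] `<=` B & A `&` B = set0].
Proof.
rewrite open_hausdorff => sep.
elim: s => [_|y s IH].
  exists setT, set0; split; [exact: openT|exact: open0|by []|by []|].
  by rewrite setI0.
rewrite inE negb_or => /andP[xy /IH[A [B [oA oB Ax sB AB0]]]].
have [[A' B'] /= [/set_mem A'x /set_mem B'y] [oA' oB' /eqP AB'0]] := sep _ _ xy.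
exists (A `&` A'), (B `|` B'); split => //; [exact: openI|exact: openU| |].
  move=> z /=; rewrite inE => /orP[/eqP ->|zs]; [by right|by left; exact: sB].
rewrite -subset0 => z [[Az A'z] [Bz|B'z]]; first by rewrite -AB0.
by rewrite -AB'0.
Qed.

(** Separation lets the neighbourhoods of finitely many points of a fibre be
taken disjoint, so that the masses add up. *)
Lemma near_sum_seq (y : Y) (s : seq X) (W : set X) :
  hausdorff_space X -> locally_constant_mass ->
  uniq s -> {in s, forall x, f x = y} -> open W -> [set` s] `<=` W ->
  exists N : set X, [/\ open N, [set` s] `<=` N, N `<=` W &
    \forall y' \near y, finite_set (N `&` fibre y') /\
      (\sum_(z \in N `&` fibre y') m z)%N = (\sum_(x <- s) m x)%N].
Proof.
move=> hX hm; elim: s W => [|x s IH] W /=.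
  move=> _ _ _ _; exists set0; split => //; first exact: open0.
  by near=> y'; rewrite set0I fsbig_set0 big_nil.
case/andP=> xs us sy oW sW.
have [A [B [oA oB Ax sB AB0]]] := separate_point_seq hX xs.
have [||N [oN sN NW nearN]] := IH (W `&` B) us _ (openI oW oB).
- by move=> z zs; apply: sy; rewrite inE zs orbT.
- by move=> z zs; split; [apply: sW; rewrite /= inE (zs : z \in s) orbT|exact: sB].
have Wx : W x by apply: sW; rewrite /= mem_head.
have nWA : nbhs x (W `&` A) by apply: open_nbhs_nbhs; split; [exact: openI|].
have [M [oM Mx MW nearM]] := hm _ _ nWA.
exists (M `|` N); split; first exact: openU.
- by move=> z /=; rewrite inE => /orP[/eqP ->|/sN]; [left|right].
- by move=> z [/MW[]|/NW[]].
rewrite (sy _ (mem_head _ _)) in nearM.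
near=> y'.
have [finM sumM] : finite_set (M `&` fibre y') /\
   (\sum_(z \in M `&` fibre y') m z)%N = m x by near: y'.
have [finN sumN] : finite_set (N `&` fibre y') /\
   (\sum_(z \in N `&` fibre y') m z)%N = (\sum_(x <- s) m x)%N by near: y'.
rewrite setIUl; split; first by rewrite finite_setU.
rewrite fsbigU0 //= ?sumM ?sumN ?big_cons//.
move=> z [[/MW[_ Az] _] [/NW[_ Bz] _]].
by rewrite -[set0]AB0.
Unshelve. all: by end_near. Qed.

Hypotheses (cX : compact [set: X]) (hX : hausdorff_space X).
Hypotheses (hY : hausdorff_space Y) (cf : continuous f).
Hypothesis hm : locally_constant_mass.

(** A fibre is compact, and each of its points has a neighbourhood that meets it
in a finite set. *)
Lemma finite_fibre (y : Y) : finite_set (fibre y).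
Proof.
have clF : closed (fibre y).
  apply: closed_comp => //; apply: compact_closed => //; exact: compact_set1.
have cF : compact (fibre y) by apply: subclosed_compact clF cX _.
have [N NP] : {N : X -> set X & forall x, [/\ open (N x), N x x &
    f x = y -> finite_set (N x `&` fibre y)]}.
  apply: (@choice _ _ (fun x N => [/\ open N, N x & f x = y -> finite_set (N `&` fibre y)])).
  move=> x; have [N [oN Nx _ near1]] := hm (@filterT _ (nbhs x) _).
  exists N; split => // <-; exact: (nbhs_singleton near1).1.
rewrite compact_cover in cF.
have [||D Dsub cov] := cF _ (fibre y) N.
- by move=> x _; have [] := NP x.
- by move=> x Fx; exists x => //; have [] := NP x.
apply: (@sub_finite_set _ _ (\bigcup_(x in [set` D]) (N x `&` fibre y))).
  by move=> z Fz; have [x Dx Nz] := cov z Fz; exists x.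
apply: bigcup_finite; first exact: finite_fset.
by move=> x Dx; have [_ _] := NP x; apply; have := Dsub _ Dx; rewrite inE.
Qed.

(** By compactness the image of the complement of a neighbourhood [N] of
[fibre y] is closed and misses [y], so nearby fibres lie entirely in [N]. *)
Lemma near_fibre_sum (y : Y) :
  \forall y' \near y,
    (\sum_(x \in fibre y') m x)%N = (\sum_(x \in fibre y) m x)%N.
Proof.
rewrite (fsbig_finite _ _ (finite_fibre y)) /=.
set s := (X in (\sum_(_ <- X) _)%N).
have sE z : z \in s = (f z == y) :> bool.
  by rewrite in_fset_set ?inE; [exact: asbool_equiv_eqP eqP _|exact: finite_fibre].
have [|||N [oN sN _ nearN]] := @near_sum_seq y s setT hX hm _ _ openT.
- exact: fset_uniq.
- by move=> z; rewrite sE => /eqP.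
- by [].
have clI : closed (f @` ~` N).
  apply: compact_closed => //; apply: continuous_compact.
    exact: continuous_subspaceT.
  exact: subclosed_compact (open_closedC oN) cX _.
have : nbhs y (~` (f @` ~` N)).
  apply: open_nbhs_nbhs; split; first exact: closed_openC.
  by case=> z Nz fz; apply: Nz; apply: sN; rewrite /= sE fz.
move=> nearC; near=> y'.
have <- : N `&` fibre y' = fibre y'.
  apply: setIidr => z fz; apply: contrapT => Nz.
  suff : (~` (f @` ~` N)) y' by apply; exists z.
  by near: y'.
have [] // : finite_set (N `&` fibre y') /\
   (\sum_(z \in N `&` fibre y') m z)%N = (\sum_(x <- s) m x)%N by near: y'.
Unshelve. all: by end_near. Qed.

End FibreSums.

(** * The sphere is compact, separated and connected *)

Section SphereTopology.
Context {R : realType}.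
Local Notation C := (plane R).
Local Notation S2 := (sphere R).
Local Notation Re := (@complex.Re R).
Local Notation Im := (@complex.Im R).
Local Notation "x %:C" := (real_complex R x) : ring_scope.

Lemma norm_ge_Im (z : R[i]) : `|Im z|%:C <= `|z|.
Proof.
have := normc_ge_Re (z * 'i%C); rewrite ReiNIm normrN normrM.
suff -> : `|'i%C : R[i]| = 1 by rewrite mulr1.
by rewrite normc_def /= expr0n expr1n add0r sqrtr1.
Qed.

Lemma continuous_real_complex : continuous (fun a : R => (a%:C) : C).
Proof.
move=> a W /nbhs_ballP[e e0 We].
apply/nbhs_ballP; exists (Re e); first by move: e0; rewrite /= ltcE => /andP[].
move=> b ab; apply: We.
move: e0; rewrite /= ltcE /= => /andP[/eqP Ie _].
rewrite -ball_normE /ball_ /= -raddfB /= normc_def /= expr0n addr0 sqrtr_sqr.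
by rewrite ltcE /= Ie eqxx.
Qed.

Lemma continuous_Re : continuous (Re : C -> R).
Proof.
move=> z W /nbhs_ballP[e e0 We].
apply/nbhs_ballP; exists (e%:C); first by rewrite /= ltcE /= eqxx.
move=> w; rewrite -ball_normE /ball_ /= => zw; apply: We.
rewrite -ball_normE /ball_ /= -raddfB -ltcR.
exact: le_lt_trans (normc_ge_Re _) zw.
Qed.

(** The compact neighbourhoods are the images of squares of [R * R]; they are
what separates the point at infinity from the finite points. *)
Lemma locally_compact_plane : locally_compact [set: C].
Proof.
move=> z _; rewrite withinET.
pose E (p : R * R) : C := (p.1%:C) + 'i%C * (p.2%:C).
have cE : continuous E.
  move=> p; apply: cvgD.
    by apply: continuous_comp; [exact: cvg_fst|exact: continuous_real_complex].
  apply: cvgMr.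
  by apply: continuous_comp; [exact: cvg_snd|exact: continuous_real_complex].
pose B := E @` (closed_ball (Re z) 1 `*` closed_ball (Im z) 1).
have cB : compact B.
  apply: continuous_compact; first exact: continuous_subspaceT.
  by apply: compact_setX; apply: closed_ballR_compact.
exists B; last by split => //; apply: compact_closed cB; exact: norm_hausdorff.
apply/nbhs_ballP; exists 1 => //= w; rewrite -ball_normE /ball_ /= => zw.
exists (Re w, Im w); last by rewrite /E /= -complexE.
split; apply: subset_closure; rewrite -ball_normE /ball_ /= -raddfB -ltcR.
  exact: le_lt_trans (normc_ge_Re _) zw.
exact: le_lt_trans (norm_ge_Im _) zw.
Qed.

(** The point at infinity is therefore not isolated, without which the sphere
would be disconnected. *)
Lemma plane_not_compact : ~ compact [set: C].
Proof.
move=> cC.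
have : compact (range (Re : C -> R)).
  apply: continuous_compact cC; apply: continuous_subspaceT; exact: continuous_Re.
move=> /compact_bounded[M [_ HM]].
have : `| `|M| + 2 | <= M + 1.
  by apply: HM; [rewrite ltrDl ltr01|exists ((`|M| + 2)%:C)].
apply/negP; rewrite -ltNge ger0_norm ?addr_ge0//.
by rewrite (le_lt_trans (lerD (ler_norm M) (lexx 1)))// ltrD2l ltr1n.
Qed.

Lemma sphere_hausdorff : hausdorff_space S2.
Proof.
apply: one_point_compactification_hausdorff; first exact: locally_compact_plane.
exact: norm_hausdorff.
Qed.

Lemma sphere_compact : compact [set: S2].
Proof. exact: one_point_compactification_compact. Qed.

(** The plane is the union of the segments from [0]. *)
Lemma plane_connected : connected [set: C].
Proof.
have -> : [set: C] = \bigcup_(z in [set: C]) ((fun t : R => z * (t%:C)) @` `[0, 1]).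
  apply/seteqP; split => // z _; exists z => //; exists 1; last by rewrite mulr1.
  by rewrite /= in_itv /= ler01 lexx.
apply: bigcup_connected.
  exists 0 => z _; exists 0; last by rewrite mulr0.
  by rewrite /= in_itv /= ler01 lexx.
move=> z _; apply: connected_continuous_connected; first exact: segment_connected.
apply: continuous_subspaceT => t; apply: cvgMr; exact: continuous_real_complex.
Qed.

Lemma sphere_connected : connected [set: S2].
Proof.
have -> : [set: S2] = closure (Some @` [set: C] : set S2).
  apply/seteqP; split => // -[z _|_]; first by apply: subset_closure; exists z.
  move=> W [K [cK _] KW].
  have [z nKz] : exists z, ~ K z.
    apply: contrapT => /forallNP nK; apply: plane_not_compact.
    suff -> : [set: C] = K by [].
    by apply/seteqP; split => // z _; apply: contrapT; exact: nK.
  by exists (Some z); split; [exists z|apply: KW; left; exists z].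
apply: connected_closure; apply: connected_continuous_connected plane_connected _.
apply: continuous_subspaceT; exact: one_point_compactification_some_continuous.
Qed.

End SphereTopology.

Lemma locally_constant_connected {X : topologicalType} {T : Type} (c : X -> T) :
  connected [set: X] -> (forall x, \forall y \near x, c y = c x) ->
  forall x y, c x = c y.
Proof.
move=> cX lc x y.
suff : [set z | c z = c y] = setT by move/seteqP => [_ /(_ x I)].
apply: cX; first by exists y.
  exists [set z | c z = c y]; last by rewrite setTI.
  by rewrite openE => z /= zy; rewrite -zy; exact: lc.
exists [set z | c z = c y]; last by rewrite setTI.
rewrite -openC openE => z /= zy; apply: filterS (lc z) => w wz /=.
by rewrite wz.
Qed.

(** * Local normal form and local injectivity *)

Section LocalNormalForm.
Context {R : realType}.
Local Notation C := (plane R).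
Local Notation S2 := (sphere R).
Implicit Types (f : S2 -> S2) (p x y : S2) (N W : set S2).

Definition locally_injective f p :=
  exists2 N, nbhs p N & forall x y, N x -> N y -> f x = f y -> x = y.

(** The part of [local_degree f p d] used for counting: [phi] identifies a
neighbourhood [N] of [p] with the disc of radius [r], and there the fibres of
[f] are those of [phi x ^+ d].  The chart of the target survives only through
the last two fields, where [a] is the coordinate of [y]; the bound [r ^+ d] on
[a] is what keeps all [d]-th roots of [a] in the disc.  The radius is a
complex number because the norm of the plane takes complex values. *)
Record power_disc f p (d : nat) N (phi : S2 -> C) (r : C) : Prop := PowerDisc {
  disc_open : open N;
  disc_center : N p;
  disc_coord0 : phi p = 0;
  disc_cont : forall x, N x -> {for x, continuous phi};
  disc_inj : forall x y, N x -> N y -> phi x = phi y -> x = y;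
  disc_radius : 0 < r;
  disc_surj : forall w, `|w| < r -> exists2 x, N x & phi x = w;
  disc_power : forall x y, N x -> N y -> (f x = f y <-> phi x ^+ d = phi y ^+ d);
  disc_near : \forall y \near f p, exists a : C,
    `|a| < r ^+ d /\ forall x, N x -> (f x = y <-> phi x ^+ d = a) }.

(** Both charts being open, the chart of the source can be cut down to the
preimage of a small disc; no chart of the target has to be shrunk, since [y]
close to [f p] already has a coordinate of norm less than [r ^+ d]. *)
Lemma local_degree_power_disc f p d W :
  local_degree f p d -> nbhs p W ->
  exists N phi r, power_disc f p d N phi r /\ N `<=` W.
Proof.
move=> [d0 [U [V [phi [psi [[[oU Up phip] [cphi iphi ophi _]]]]]]]].
move=> [[oV Vp psip] [cpsi ipsi _ _]] fUV pow nW.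
have oW : open (W° `&` U) by apply: openI => //; exact: open_interior.
have : nbhs (0 : C) (phi @` (W° `&` U)).
  apply: open_nbhs_nbhs; split; first by apply: ophi => // x [].
  by exists p.
move=> /nbhs_ballP[r /= r0 rsub].
exists ((W° `&` U) `&` [set x | `|phi x| < r]), phi, r; split; last first.
  by move=> x [[/interior_subset Wx _] _].
have powW x : ((W° `&` U) `&` [set x | `|phi x| < r]) x ->
  [/\ U x, V (f x) & psi (f x) = phi x ^+ d].
  by move=> [[_ Ux] _]; split => //; [apply: fUV; exists x|exact: pow].
split => //.
- rewrite openE => x [WUx phix]; apply: filterI; first exact: open_nbhs_nbhs.
  apply: (cphi x WUx.2 [set w | `|w| < r]); apply/nbhs_ballP; exists (r - `|phi x|).
    by rewrite /= subr_gt0.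
  move=> w; rewrite -ball_normE /ball_ /= ltrBrDl; apply: le_lt_trans.
  by rewrite -{1}(subrKC (phi x) w) distrC ler_normD.
- by split; [split|rewrite /= phip normr0].
- by move=> x [[_ Ux] _]; exact: cphi.
- by move=> x y [[_ Ux] _] [[_ Uy] _]; apply: iphi; exact/mem_set.
- move=> w wr; have [|x Wx phix] := rsub w.
    by rewrite -ball_normE /ball_ /= sub0r normrN.
  by exists x => //; split => //; rewrite /= phix.
- move=> x y /powW[Ux Vfx <-] /powW[Uy Vfy <-]; split=> [->//|].
  by apply: ipsi; exact/mem_set.
- have nb : nbhs (psi (f p)) [set w : C | `|w| < r ^+ d].
    apply/nbhs_ballP; exists (r ^+ d); first by rewrite /= exprn_gt0.
    by move=> w; rewrite psip -ball_normE /ball_ /= sub0r normrN.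
  have nbp := cpsi _ Vp [set w : C | `|w| < r ^+ d] nb.
  near=> y; exists (psi y); split; first by near: y.
  have Vy : V y by near: y; exact: open_nbhs_nbhs.
  move=> x /powW[Ux Vfx <-]; split=> [->//|].
  by apply: ipsi; exact/mem_set.
Unshelve. all: by end_near. Qed.

Lemma power_disc1_injective f p N phi r x y :
  power_disc f p 1 N phi r -> N x -> N y -> f x = f y -> x = y.
Proof.
by move=> D Nx Ny /(disc_power D Nx Ny); rewrite !expr1; exact: disc_inj D _ _ _ _.
Qed.

(** If [phi a] and [phi b] have the same square and both are closer to [phi x]
than [0] is, they cannot be opposite. *)
Lemma power_disc2_locally_injective f p N phi r x :
  power_disc f p 2 N phi r -> N x -> x != p -> locally_injective f x.
Proof.
move=> D Nx xp.
have w0 : 0 < `|phi x|.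
  rewrite normr_gt0; apply: contra_neq xp => phix.
  by apply: (disc_inj D) => //; [exact: disc_center D|rewrite (disc_coord0 D)].
exists (N `&` [set z | `|phi x - phi z| < `|phi x| ]).
  apply: filterI; first by apply: open_nbhs_nbhs; split=> //; exact: disc_open D.
  have nb : nbhs (phi x) [set w : C | `|phi x - w| < `|phi x| ].
    by apply/nbhs_ballP; exists `|phi x| => // w; rewrite -ball_normE.
  exact: (disc_cont D Nx nb).
move=> a b [Na /= ha] [Nb /= hb] /(disc_power D Na Nb) /eqP.
rewrite eqf_sqr => /orP[/eqP|/eqP ab]; first exact: disc_inj D _ _ Na Nb.
have := ler_ltD (ltW ha) hb; rewrite -mulr2n => /(le_lt_trans (ler_normD _ _)).
by rewrite ab opprK addrACA subrr addr0 -mulr2n normrMn ltxx.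
Qed.

(** Arbitrarily close to [p] there are points with opposite coordinates. *)
Lemma local_degree2_not_locally_injective f p :
  local_degree f p 2 -> ~ locally_injective f p.
Proof.
move=> ld [W nW inj].
have [N [phi [r [D NW]]]] := local_degree_power_disc ld nW.
have r2 : 0 < r / 2 by rewrite divr_gt0 ?(disc_radius D).
have lt : `|(r / 2 : C)| < r.
  by rewrite (gtr0_norm r2) ltr_pdivrMr// ltr_pMr ?(disc_radius D)// ltr1n.
have [a Na ha] := disc_surj D lt.
have [b Nb hb] : exists2 b, N b & phi b = - (r / 2).
  by apply: (disc_surj D); rewrite normrN.
have ab : a = b.
  by apply: inj; [exact: NW|exact: NW|apply/(disc_power D Na Nb)];
     rewrite ha hb sqrrN.
move: hb; rewrite -ab ha => /eqP; rewrite -subr_eq0 opprK -mulr2n mulrn_eq0 /=.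
by rewrite gt_eqF.
Qed.

End LocalNormalForm.

(** * The degree of a simply branched covering of the sphere *)

Section SimplyBranched.
Context {R : realType}.
Local Notation C := (plane R).
Local Notation S2 := (sphere R).
Variable f : S2 -> S2.
Local Notation fibre y := (f @^-1` [set y]).

Definition simply_branched :=
  oriented_branched_covering f /\ forall c, critical f c -> local_degree f c 2.

(** The local degree as a function; with values in [{1, 2}] it is the local
degree only for a simply branched [f]. *)
Definition multiplicity (x : S2) : nat := if `[< critical f x >] then 2 else 1.

Lemma multiplicity_critical x : critical f x -> multiplicity x = 2%N.
Proof. by rewrite /multiplicity; case: asboolP. Qed.

Lemma multiplicity_noncritical x : ~ critical f x -> multiplicity x = 1%N.
Proof. by rewrite /multiplicity; case: asboolP. Qed.

Hypothesis sf : simply_branched.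

(** Some local degree exists, and it is less than 2. *)
Lemma local_degree1_noncritical x : ~ critical f x -> local_degree f x 1.
Proof.
have [d ld] := sf.1.2 x; move=> ncr.
suff d1 : d = 1%N by rewrite d1 in ld.
apply/eqP; rewrite eqn_leq ld.1 andbT leqNgt; apply/negP => d2.
by apply: ncr; exists d.
Qed.

Lemma locally_injective_noncritical x : locally_injective f x -> ~ critical f x.
Proof. by move=> li /sf.2 /local_degree2_not_locally_injective. Qed.

(** At a noncritical point a disc meets each nearby fibre once.  At a critical
point [x] the trace of a fibre on the disc is the pair of points whose
coordinates are the two square roots of a number [a]: either [a = 0] and both
are [x], of multiplicity 2, or they are two distinct points, noncritical
because [f] is injective near each of them. *)
Lemma multiplicity_locally_constant_mass : locally_constant_mass f multiplicity.
Proof.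
move=> x W nW; have [crx|ncrx] := pselect (critical f x); last first.
  have [N [phi [r [D NW]]]] :=
    local_degree_power_disc (local_degree1_noncritical ncrx) nW.
  exists N; split => //; [exact: disc_open D|exact: disc_center D|].
  apply: filterS (disc_near D) => y [a []]; rewrite expr1 => ar Na.
  have [z Nz phiz] := disc_surj D ar.
  have -> : N `&` fibre y = [set z].
    apply/seteqP; split=> [w [Nw fw]|_ ->].
      apply: (disc_inj D) => //; rewrite phiz.
      by have := (Na w Nw).1 fw; rewrite expr1.
    by split => //=; apply/Na => //; rewrite expr1.
  split; first exact: finite_set1.
  rewrite fsbig_set1 !multiplicity_noncritical//; apply: locally_injective_noncritical.
  exists N; first by apply: open_nbhs_nbhs; split => //; exact: disc_open D.
  by move=> u v Nu Nv; exact: power_disc1_injective D Nu Nv.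
have [N [phi [r [D NW]]]] := local_degree_power_disc (sf.2 _ crx) nW.
exists N; split => //; [exact: disc_open D|exact: disc_center D|].
apply: filterS (disc_near D) => y [a [ar2 Na]].
pose s : C := sqrtC (a : R[i]).
have sE : s ^+ 2 = a by exact: sqrtCK.
have sr : `|s| < r.
  rewrite -(@ltr_pXn2r _ 2)// ?nnegrE ?(ltW (disc_radius D))//.
  by rewrite -normrX sE.
have [u Nu phiu] := disc_surj D sr.
have [v Nv phiv] : exists2 v, N v & phi v = - s.
  by apply: (disc_surj D); rewrite normrN.
have fibE : N `&` fibre y = [set u] `|` [set v].
  apply/seteqP; split=> [w [Nw fw]|].
    have /eqP := (Na w Nw).1 fw; rewrite -sE eqf_sqr => /orP[]/eqP ws.
      by left; apply: (disc_inj D) => //; rewrite phiu.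
    by right; apply: (disc_inj D) => //; rewrite phiv.
  move=> w [->|->]; split => //=; apply/Na => //.
    by rewrite phiu.
  by rewrite phiv sqrrN.
split; first by rewrite fibE finite_setU; split; exact: finite_set1.
rewrite (multiplicity_critical crx) fibE.
have Nx := disc_center D; have phix := disc_coord0 D.
have [s0|s0] := eqVneq s 0.
  have -> : u = x by apply: (disc_inj D) => //; rewrite phiu phix.
  have -> : v = x by apply: (disc_inj D) => //; rewrite phiv phix s0 oppr0.
  by rewrite setUid fsbig_set1 multiplicity_critical.
have ncr w : N w -> phi w != 0 -> multiplicity w = 1%N.
  move=> Nw phiw; apply/multiplicity_noncritical/locally_injective_noncritical.
  apply: (power_disc2_locally_injective D Nw).
  by apply: contra_neq phiw => ->.
rewrite fsbigU0 ?fsbig_set1 /=.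
- by rewrite !ncr// ?phiu ?phiv ?oppr_eq0.
- exact: finite_set1.
- exact: finite_set1.
- move=> w [-> uv]; move: phiv; rewrite -uv phiu => /eqP.
  by rewrite -subr_eq0 opprK -mulr2n mulrn_eq0 /= (negPf s0).
Qed.

Lemma finite_fibre_sphere y : finite_set (fibre y).
Proof.
apply: finite_fibre; [exact: sphere_compact| | |exact: multiplicity_locally_constant_mass].
- exact: sphere_hausdorff.
- exact: sf.1.1.
Qed.

Lemma fibre_sum_constant : exists d : nat,
  forall y, (\sum_(x \in fibre y) multiplicity x)%N = d.
Proof.
pose mass y := (\sum_(x \in fibre y) multiplicity x)%N.
exists (mass None) => y.
apply: (@locally_constant_connected _ _ mass sphere_connected) => z.
apply: near_fibre_sum; [exact: sphere_compact| | | |].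
- exact: sphere_hausdorff.
- exact: sphere_hausdorff.
- exact: sf.1.1.
- exact: multiplicity_locally_constant_mass.
Qed.

End SimplyBranched.

(** * Post-composition with a homeomorphism *)

Section Postcomposition.
Context {R : realType}.
Local Notation C := (plane R).
Local Notation S2 := (sphere R).
Implicit Types (f h k u v : S2 -> S2) (p : S2).

Lemma loop_in_comp u (A B : set S2) (gamma : R -> S2) :
  continuous u -> (forall x, A x -> B (u x)) ->
  loop_in A gamma -> loop_in B (u \o gamma).
Proof.
move=> cu AB [cg g01 gA]; split => /=; first last.
- by move=> t /gA /AB.
- by rewrite g01.
by move=> t; exact: (cvg_comp _ _ (cg t) (cu _)).
Qed.

(** Injectivity of [u] keeps the image of a loop around [p] away from [u p], so
that the condition on [v] applies to it. *)
Lemma orientation_preserving_at_comp u v p :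
  continuous u -> injective u -> orientation_preserving_at u p ->
  orientation_preserving_at v (u p) -> orientation_preserving_at (v \o u) p.
Proof.
move=> cu iu [N nN HN] [M nM HM].
exists (N `&` u @^-1` M); first by apply: filterI => //; exact: cu.
move=> gamma n lg.
have lN : loop_in (N `\ p) gamma.
  by case: lg => ? ? lg; split => // t /lg [[Nt _] tp].
have lM : loop_in (M `\ u p) (u \o gamma).
  apply: loop_in_comp lg => // x [[_ Mx] xp]; split => // /iu; exact: xp.
by rewrite (HN _ _ lN) (HM _ _ lM).
Qed.

Lemma orientation_preserving_at_inverse h k p :
  continuous k -> cancel h k -> cancel k h ->
  orientation_preserving_at h (k p) -> orientation_preserving_at k p.
Proof.
move=> ck hk kh [N nN HN]; exists (k @^-1` N); first exact: ck.
move=> gamma n lg.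
have lN : loop_in (N `\ k p) (k \o gamma).
  by apply: loop_in_comp lg => // x [Nx xp]; split => // /(can_inj kh); exact: xp.
rewrite (HN _ _ lN) kh.
suff -> : sphere_coord p \o h \o (k \o gamma) = sphere_coord p \o gamma by [].
by apply/funext => t /=; rewrite kh.
Qed.

Lemma orientation_preserving_inverse h k :
  continuous k -> cancel h k -> cancel k h ->
  orientation_preserving h -> orientation_preserving k.
Proof.
by move=> ck hk kh oh p; apply: (orientation_preserving_at_inverse ck hk kh (oh _)).
Qed.

Lemma oriented_chart_inverse h k V (psi : S2 -> C) p :
  continuous h -> continuous k -> cancel h k -> cancel k h ->
  orientation_preserving k ->
  oriented_chart V psi p -> oriented_chart (k @^-1` V) (psi \o k) (h p).
Proof.
move=> ch ck hk kh ok [[oV Vp psip] [cpsi ipsi opsi orpsi]].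
split; split => /=; rewrite ?hk//.
- by apply: open_comp => // x _; exact: ck.
- by move=> x Vx; apply: continuous_comp; [exact: ck|exact: cpsi].
- move=> x y /set_mem Vx /set_mem Vy e; apply: (can_inj kh).
  by apply: ipsi e; exact/mem_set.
- move=> W oW WV; rewrite -image_comp.
  have -> : k @` W = h @^-1` W.
    apply/seteqP; split => [_ [x Wx <-]|x Wx] /=; first by rewrite kh.
    by exists (h x).
  apply: opsi; first by apply: open_comp => // x _; exact: ch.
  by move=> x /WV /=; rewrite hk.
- move=> x Vx.
  apply: (@orientation_preserving_at_comp k (fun y => Some (psi y) : S2)) => //.
    exact: can_inj kh.
  exact: orpsi.
Qed.

(** Keep the chart at [p] and move the one at [f p] by the inverse of [h]. *)
Lemma local_degree_postcomp f h p d :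
  homeomorphism h -> orientation_preserving h ->
  local_degree f p d -> local_degree (h \o f) p d.
Proof.
move=> [ch [k ck [hk kh]]] oh [d0 [U [V [phi [psi [cU cV fUV pow]]]]]].
split => //; exists U, (k @^-1` V), phi, (psi \o k); split => //.
- apply: (@oriented_chart_inverse h k V psi (f p)) => //.
  exact: (orientation_preserving_inverse ck hk kh oh).
- by move=> _ [x Ux <-] /=; rewrite hk; apply: fUV; exists x.
- by move=> x Ux /=; rewrite hk; exact: pow.
Qed.

Lemma homeomorphism_inverse h : homeomorphism h -> orientation_preserving h ->
  exists k, [/\ cancel h k, cancel k h, homeomorphism k & orientation_preserving k].
Proof.
move=> [ch [k ck [hk kh]]] oh; exists k; split => //; first by split => //; exists h.
exact: (orientation_preserving_inverse ck hk kh oh).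
Qed.

Lemma critical_postcomp f h : homeomorphism h -> orientation_preserving h ->
  critical (h \o f) = critical f.
Proof.
move=> hh oh; have [k [hk kh hhk ok]] := homeomorphism_inverse hh oh.
apply/seteqP; split => c [d d2 ld]; exists d => //; last first.
  exact: local_degree_postcomp.
have -> : f = k \o (h \o f) by apply/funext => x /=; rewrite hk.
exact: local_degree_postcomp.
Qed.

Lemma simply_branched_postcomp f h : homeomorphism h -> orientation_preserving h ->
  simply_branched f -> simply_branched (h \o f).
Proof.
move=> hh oh [[cf ldf] sf]; split; first split.
- by move=> x; apply: continuous_comp; [exact: cf|exact: hh.1].
- by move=> p; have [d ld] := ldf p; exists d; exact: local_degree_postcomp.
- by move=> c; rewrite critical_postcomp// => /sf; exact: local_degree_postcomp.
Qed.

End Postcomposition.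

(** * Postcritical sets *)

Section PostcriticalSet.
Context {R : realType}.
Local Notation S2 := (sphere R).
Implicit Types (f : S2 -> S2) (A : set S2).

Lemma critical_value_postcritical f c : critical f c -> postcritical f (f c).
Proof. by move=> cc; exists 1%N, c. Qed.

Lemma postcritical_forward f x : postcritical f x -> postcritical f (f x).
Proof. by move=> [m [c [m1 cc ->]]]; exists m.+1, c. Qed.

(** The postcritical set is the smallest forward invariant set containing the
critical values. *)
Lemma postcritical_sub f A :
  (forall c, critical f c -> A (f c)) -> (forall x, A x -> A (f x)) ->
  postcritical f `<=` A.
Proof.
move=> cA fA _ [m [c [m1 cc ->]]].
case: m m1 => // m _; elim: m => [|m IH]; first exact: cA.
exact: fA.
Qed.

End PostcriticalSet.

(** * Counting preimages *)

Section Counting.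
Context {R : realType}.
Local Notation S2 := (sphere R).
Local Notation "# A" := (size (finmap.enum_fset (fset_set A))) (at level 8).
Implicit Types (A B P Q : set S2).

Lemma fset_set_eq_of_leq A B : finite_set B -> A `<=` B -> (#B <= #A)%N -> A = B.
Proof.
move=> fB AB le.
have fA := sub_finite_set AB fB.
have /eqP e : fset_set A == fset_set B.
  rewrite eqEfcard le andbT; apply/fsubsetP => x.
  by rewrite !in_fset_set// !inE; exact: AB.
by rewrite -(fset_setK fA) e fset_setK.
Qed.

Variable f : S2 -> S2.
Hypothesis sf : simply_branched f.
Local Notation fibre y := (f @^-1` [set y]).
Local Notation mult := (multiplicity f).

Lemma sum_multiplicity_noncritical A :
  finite_set A -> A `&` critical f = set0 -> (\sum_(x \in A) mult x)%N = #A.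
Proof.
move=> fA A0; rewrite -sum1_size -(fsbig_finite _ _ fA).
apply: eq_fsbigr => x /set_mem Ax; apply: multiplicity_noncritical => cx.
by rewrite -[False]/(set0 x) -A0.
Qed.

Lemma sum_multiplicity_critical A :
  finite_set A -> A `<=` critical f -> (\sum_(x \in A) mult x)%N = (#A * 2)%N.
Proof.
move=> fA Ac; rewrite (eq_fsbigr (fun=> 2%N)); last first.
  by move=> x /set_mem /Ac; exact: multiplicity_critical.
by rewrite fsbig_finite// big_const_seq count_predT mulnC; exact: iter_addn_0.
Qed.

Variable d : nat.
Hypothesis hd : forall y, (\sum_(x \in fibre y) mult x)%N = d.

Lemma sum_multiplicity_preimage P : finite_set P ->
  finite_set (f @^-1` P) /\ (\sum_(x \in f @^-1` P) mult x)%N = (#P * d)%N.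
Proof.
move=> fP.
have PE : P = [set` finmap.enum_fset (fset_set P)] by rewrite -{1}(fset_setK fP).
rewrite {1 2}PE; move: (fset_uniq (fset_set P)); move: {PE}(finmap.enum_fset _).
elim=> [_|y s IH].
  have -> : f @^-1` [set` [::]] = set0 by apply/seteqP; split.
  by rewrite fsbig_set0.
move=> /= /andP[ys /IH[fs ss]].
have -> : f @^-1` [set` y :: s] = fibre y `|` f @^-1` [set` s].
  apply/seteqP; split => x /=; rewrite inE.
    by move=> /orP[/eqP|]; [left|right].
  by move=> [->|->]; rewrite ?eqxx ?orbT.
have fy := finite_fibre_sphere sf y.
split; first by rewrite finite_setU.
rewrite fsbigU0 ?hd ?ss ?mulSn//.
by move=> x [/= -> ys']; move: ys; rewrite (ys' : y \in s).
Qed.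

Lemma has_degree_of_sum : has_degree f d.
Proof.
move=> y ny; have fy := finite_fibre_sphere sf y.
rewrite -(fset_setK fy); apply/card_eq_fsetP.
rewrite -sum_multiplicity_noncritical ?hd//.
by rewrite -subset0 => x [/= fx cx]; apply: ny; exists x.
Qed.

Lemma degree_ge2 c : critical f c -> (2 <= d)%N.
Proof.
move=> cc; have fy := finite_fibre_sphere sf (f c).
rewrite -(hd (f c)) (fsbigD1 c)//= (multiplicity_critical cc).
exact: leq_addr.
Qed.

(** The preimage of a set containing the critical values contains all critical
points, each of multiplicity 2. *)
Lemma critical_count P : finite_set P -> (forall c, critical f c -> P (f c)) ->
  (#P * d = #(f @^-1` P `\` critical f) + #(critical f) * 2)%N.
Proof.
move=> fP cP; have [fpre <-] := sum_multiplicity_preimage fP.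
have cpre : critical f `<=` f @^-1` P by move=> c /cP.
have fc := sub_finite_set cpre fpre.
have fn := sub_finite_set (@subDsetl _ (f @^-1` P) (critical f)) fpre.
have e : f @^-1` P = (f @^-1` P `\` critical f) `|` critical f.
  by rewrite setUC setDUK.
rewrite {1}e fsbigU0 ?(sum_multiplicity_critical fc) ?(sum_multiplicity_noncritical fn)//.
  by rewrite setIC setDIK.
by move=> x [[]].
Qed.

(** With [K] critical points, [critical_count] gives [4 d = 4 + 2 K] for [P] and
[#Q d >= #Q + 2 K] for [Q]; eliminating [K] leaves [(#Q - 4) (d - 1) >= 0]. *)
Lemma four_le_card P Q E c : critical f c ->
  finite_set P -> finite_set Q ->
  (forall c, critical f c -> P (f c)) -> (forall c, critical f c -> Q (f c)) ->
  #P = 4%N -> #(f @^-1` P `\` critical f) = 4%N ->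
  E `<=` f @^-1` Q `\` critical f -> #E = #Q -> (4 <= #Q)%N.
Proof.
move=> cc fP fQ cP cQ P4 N4 EQ EQc.
have d2 := degree_ge2 cc.
have hP := critical_count fP cP.
have hQ := critical_count fQ cQ.
have fN : finite_set (f @^-1` Q `\` critical f).
  exact: sub_finite_set (@subDsetl _ _ _) (sum_multiplicity_preimage fQ).1.
have le : (#Q <= #(f @^-1` Q `\` critical f))%N.
  rewrite -EQc; apply: fsubset_leq_card; apply/fsubsetP => x.
  by rewrite !in_fset_set ?inE//; [exact: EQ|exact: sub_finite_set EQ fN].
move: hP hQ le; rewrite P4 N4.
move: (#Q) (# (f @^-1` Q `\` critical f)) (#(critical f)) => k n K.
nia.
Qed.

End Counting.

(** * Nearly Euclidean maps and their Euclidean factors *)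

Section Composites.
Context {R : realType}.
Local Notation S2 := (sphere R).
Local Notation "# A" := (size (finmap.enum_fset (fset_set A))) (at level 8).
Implicit Types (f g h : S2 -> S2).

Lemma NET_map_simply_branched f : NET_map f -> simply_branched f.
Proof. by move=> [[bf _] sf _]. Qed.

(** [h @` postcritical g] contains the critical values of [h \o g] and is
forward invariant, so it bounds the postcritical set from above. *)
Lemma NET_map_postcomp g h : NET_map g ->
  homeomorphism h -> orientation_preserving h ->
  h @` postcritical g `<=` g @^-1` postcritical g ->
  `I_4 #<= postcritical (h \o g) -> NET_map (h \o g).
Proof.
move=> Ng hh oh hP ge4.
have [_ _ P4] := Ng.
have [bf sf] := simply_branched_postcomp hh oh (NET_map_simply_branched Ng).
have sub : postcritical (h \o g) `<=` h @` postcritical g.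
  apply: postcritical_sub => [c|_ [z Pz <-]] /=.
    rewrite critical_postcomp// => cc.
    by exists (g c) => //; exact: critical_value_postcritical.
  by exists (g (h z)) => //; apply: hP; exists z.
have eq4 : postcritical (h \o g) #= `I_4.
  rewrite card_eq_le ge4 andbT -(card_le_eqr P4).
  exact: card_le_trans (subset_card_le sub) (card_image_le _ _).
by split => //; split => //; apply/finite_setP; exists 4%N.
Qed.

Lemma card_fset_set_image h A : injective h -> finite_set A -> #(h @` A) = #A.
Proof.
move=> ih fA; apply/fcard_eq => //; first exact: finite_image.
by apply: inj_card_eq => x y _ _; exact: ih.
Qed.

(** The factor is [k \o f] with [k] the inverse of [h].  As [k] maps [P2 f] to
[P1 f], the set [P1 f] is forward invariant under it; that its postcritical set
is all of [P1 f] is the count of [four_le_card], applied to [f], [P2 f] and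
[h @` postcritical g]. *)
Lemma NET_map_factor f h : NET_map f ->
  homeomorphism h -> orientation_preserving h -> h @` P1 f = P2 f ->
  exists g, [/\ f = h \o g, euclidean g, postcritical g = P1 f,
    P2 f `<=` g @^-1` postcritical g &
    h @` postcritical g `<=` g @^-1` postcritical g].
Proof.
move=> Nf hh oh hP.
have [[_ fP2] _ P4] := Nf.
have sf := NET_map_simply_branched Nf.
have [k [hk kh hhk ok]] := homeomorphism_inverse hh oh.
have sg := simply_branched_postcomp hhk ok sf.
pose g := k \o f.
have fE : f = h \o g by apply/funext => x /=; rewrite kh.
have cE : critical g = critical f by exact: critical_postcomp.
have kP2 y : P2 f y -> P1 f (k y) by rewrite -hP => -[z P1z <-]; rewrite hk.
have Pgsub : postcritical g `<=` P1 f.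
  apply: postcritical_sub => [c|x [fx _]]; last exact: kP2.
  by rewrite cE => cc; apply: kP2; exact: critical_value_postcritical.
have hinj : injective h := can_inj hk.
have P1E : P1 f = k @` P2 f.
  rewrite -hP image_comp; apply/seteqP; split => [x Px|_ [x Px <-]] /=.
    by exists x => //=; rewrite hk.
  by rewrite hk.
have fP1 : finite_set (P1 f) by rewrite P1E; exact: finite_image.
have P2_4 : #(P2 f) = 4%N := card_fset_set P4.
have P1_4 : #(P1 f) = 4%N by rewrite -(card_fset_set_image hinj fP1) hP.
have fPg := sub_finite_set Pgsub fP1.
have [c cc] : exists c, critical f c.
  have : P2 f !=set0.
    apply/set0P/negP => /eqP P0; move: P2_4.
    by rewrite P0 fset_set0.
  by move=> [y [m [c [_ cc _]]]]; exists c.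
have [df hdf] := fibre_sum_constant sf.
have ge4 : (4 <= #(postcritical g))%N.
  rewrite -(card_fset_set_image hinj fPg).
  apply: (four_le_card (E := postcritical g) sf hdf cc fP2) => //.
  - exact: finite_image.
  - by move=> c' /critical_value_postcritical.
  - move=> c' cc'; exists (g c'); last by rewrite /= kh.
    by apply: critical_value_postcritical; rewrite cE.
  - move=> x Px; split; last by have [] := Pgsub _ Px.
    exists (g x); last by rewrite /= kh.
    exact: postcritical_forward.
  - by rewrite card_fset_set_image.
have PgE : postcritical g = P1 f.
  by apply: fset_set_eq_of_leq => //; rewrite P1_4.
exists g; split => //.
- split; first by split => //; exact: sg.1.
  split; last 2 first.
  + rewrite -(card_le_eqr P4) PgE P1E; exact: card_image_le.
  + by rewrite PgE cE -subset0 => x [[_ ncx] cx].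
  + have [d hd] := fibre_sum_constant sg.
    exists d; last exact: has_degree_of_sum.
    by apply: (degree_ge2 sg hd (c := c)); rewrite cE.
  + exact: sg.2.
- move=> y P2y; rewrite PgE; apply: kP2; exact: postcritical_forward.
- rewrite PgE hP => y P2y; apply: kP2; exact: postcritical_forward.
Qed.

End Composites.

Theorem theorem2p1 (R : realType) :
  (forall g h : sphere R -> sphere R,
     NET_map g ->
     homeomorphism h -> orientation_preserving h ->
     h @` postcritical g `<=` g @^-1` postcritical g ->
     `I_4 #<= postcritical (h \o g) ->
     NET_map (h \o g))
  /\
  (forall f h : sphere R -> sphere R,
     NET_map f ->
     homeomorphism h -> orientation_preserving h ->
     h @` P1 f = P2 f ->
     exists g : sphere R -> sphere R,
       [/\ f = h \o g,
           euclidean g,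
           postcritical g = P1 f,
           P2 f `<=` g @^-1` postcritical g &
           h @` postcritical g `<=` g @^-1` postcritical g]).
Proof.
by split => [g h|f h]; [exact: NET_map_postcomp|exact: NET_map_factor].
Qed.
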